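(* Let $q$ be a prime power, $n\ge 0$, and $\varphi>0$ a real number. There exists a family of vectors $\{v_\alpha : \alpha\in\mathcal{E}_q(n)\}$ in $\mathbb{C}[B_q(n)]$ such that: (i) for every $\alpha\in\mathcal{E}_q(n)$, $A_n v_\alpha=\frac{\varphi q^{n-k}-q^k}{q-1}\,v_\alpha$, where $k=N(\alpha)$; (ii) $\{v_\alpha:\alpha\in\mathcal{E}_q(n)\}$ is a basis of $\mathbb{C}[B_q(n)]$ (hence an eigenbasis of $A_n$); (iii) the vectors $v_\alpha$, $\alpha\in\mathcal{E}_q(n)$, are pairwise orthogonal with respect to the inner product $\langle\cdot,\cdot\rangle_\pi$.
   Context: $B_q(n)$ is the set of all subspaces of $\mathbb{F}_q^n$, and $\mathbb{C}[B_q(n)]$ is the complex vector space of column vectors with components indexed by $B_q(n)$. $A_n$ is the $B_q(n)\times B_q(n)$ matrix with entries $A_n(X,Y)=1$ if $Y\subseteq X$ and $\dim X=\dim Y+1$; $A_n(X,Y)=\varphi q^{\dim X}$ if $X\subseteq Y$ and $\dim Y=\dim X+1$; $A_n(X,X)=\frac{\varphi-1}{q-1}q^{\dim X}$; and $A_n(X,Y)=0$ otherwise. For $X\in B_q(n)$ of dimension $k$ put $\pi(X)=\varphi^k q^{\binom{k}{2}}/P_q(n)$ with $P_q(n)=\prod_{j=0}^{n-1}(1+\varphi q^j)$, and $\langle u,v\rangle_\pi=\sum_{X\in B_q(n)}\overline{u(X)}v(X)\pi(X)$. For $m\ge 1$, let $\mathcal{N}_q(m)$ be the set of nontrivial irreducible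 (complex, degree one) characters of the additive group $\mathbb{F}_q^m$. Define sets of sequences inductively: $\mathcal{E}_q(0)=\{()\}$ (the empty sequence), $\mathcal{E}_q(1)=\{(0),(1)\}$, and for $n\ge 2$, $\mathcal{E}_q(n)$ consists of all sequences $(\alpha_1,\dots,\alpha_t)$ such that either $(\alpha_1,\dots,\alpha_{t-1})\in\mathcal{E}_q(n-1)$ and $\alpha_t\in\{0,1\}$, or $(\alpha_1,\dots,\alpha_{t-1})\in\mathcal{E}_q(n-2)$ and $\alpha_t\in\mathcal{N}_q(n-1)$. For $\alpha\in\mathcal{E}_q(n)$, $N(\alpha)$ is the number of entries of $\alpha$ that are nonzero (i.e., equal to $1$ or to a character in some $\mathcal{N}_q(m)$). *)

(* Defs.v *)
From HB Require Import structures.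
From mathcomp Require Import all_boot all_order all_algebra all_fingroup.
From mathcomp Require Import all_character.
From mathcomp Require Import reals complex.

Set Implicit Arguments.
Unset Strict Implicit.
Unset Printing Implicit Defensive.

Import GRing.Theory Num.Theory.

Local Open Scope ring_scope.
Local Open Scope complex_scope.

(* A subspace is represented by its canonical matrix ([vs2mx]), so there are
   finitely many over a finite field. *)
Module Export FiniteVspace.
Import VectorInternalTheory.
HB.instance Definition _ (F : finFieldType) (vT : vectType F) :=
  [Countable of {vspace vT} by <:].
HB.instance Definition _ (F : finFieldType) (vT : vectType F) :=
  [Finite of {vspace vT} by <:].
End FiniteVspace.

Notation Bq F n := {vspace 'rV[F]_n}.

Section SubspaceLattice.
Variables (R : realType) (F : finFieldType) (phi : R) (n : nat).

Local Notation q := (#|F|%:R : R).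

Definition A_entry (X Y : Bq F n) : R :=
  if (Y <= X)%VS && (\dim X == (\dim Y).+1) then 1
  else if (X <= Y)%VS && (\dim Y == (\dim X).+1) then phi * q ^+ \dim X
  else if X == Y then (phi - 1) / (q - 1) * q ^+ \dim X
  else 0.

(* [enum_rank] and [enum_val] identify Bq F n with 'I_#|{: Bq F n}|, so that
   C[B_q(n)] is the space of column vectors 'cV[R[i]]_#|{: Bq F n}|. *)
Definition A_mx : 'M[R[i]]_#|{: Bq F n}| :=
  \matrix_(i, j) (A_entry (enum_val i) (enum_val j))%:C.

Definition Pq : R := \prod_(0 <= j < n) (1 + phi * q ^+ j).

Definition pi_weight (X : Bq F n) : R :=
  phi ^+ \dim X * q ^+ 'C(\dim X, 2) / Pq.

Definition dot_pi (u v : 'cV[R[i]]_#|{: Bq F n}|) : R[i] :=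
  \sum_(X : Bq F n)
    (u (enum_rank X) 0)^* * v (enum_rank X) 0 * (pi_weight X)%:C.

End SubspaceLattice.

Section Sequences.
Variable F : finFieldType.

(* Nontrivial irreducible characters of the additive group F^m.  The group is
   abelian, so all of them have degree one; they take values in [algC], as is
   the case for all complex characters of finite groups in MathComp. *)
Definition Nq (m : nat) : seq 'CF([set: 'rV[F]_m]%G) :=
  [seq chi <- irr [set: 'rV[F]_m]%G | chi != 1].

(* An entry is 0 ([inl false]), 1 ([inl true]), or a character together with
   the dimension m of the space on which it is defined. *)
Definition entry : eqType := (bool + {m : nat & 'CF([set: 'rV[F]_m]%G)})%type.

Definition bit (b : bool) : entry := inl b.
Definition chr (m : nat) (chi : 'CF([set: 'rV[F]_m]%G)) : entry :=
  inr (Tagged (fun k => 'CF([set: 'rV[F]_k]%G)) chi).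

(* The elements of E_q(n), each listed exactly once ([Eseq_uniq]). *)
Fixpoint Eseq (n : nat) : seq (seq entry) :=
  match n with
  | 0 => [:: [::]]
  | 1 => [:: [:: bit false]; [:: bit true]]
  | (k.+1 as k1).+1 =>
      [seq rcons s (bit b) | s <- Eseq k1, b <- [:: false; true]]
      ++ [seq rcons s (chr chi) | s <- Eseq k, chi <- Nq k1]
  end.

Definition Nnz (s : seq entry) : nat := count (fun e => e != bit false) s.

Lemma Nq_uniq m : uniq (Nq m).
Proof. by apply: filter_uniq; have /free_uniq := irr_free [set: 'rV[F]_m]%G. Qed.

Lemma chr_inj m : injective (@chr m).
Proof. by move=> x y [] /eqP; rewrite -tag_eqE /tag_eq eqxx /= tagged_asE => /eqP. Qed.

Lemma EseqSS n : Eseq n.+2 =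
  [seq rcons s (bit b) | s <- Eseq n.+1, b <- [:: false; true]]
  ++ [seq rcons s (chr chi) | s <- Eseq n, chi <- Nq n.+1].
Proof. by []. Qed.

Lemma Eseq_uniq n : uniq (Eseq n).
Proof.
suff: uniq (Eseq n) && uniq (Eseq n.+1) by case/andP.
elim: n => [//|n /andP[U0 U1]]; rewrite U1 andTb EseqSS cat_uniq; apply/and3P; split.
- by apply: allpairs_uniq => // -[s b] [t c] _ _ /= /rcons_inj[-> ->].
- apply/hasPn => _ /allpairsP[[s x] [_ _ ->]]; apply/negP.
  by case/allpairsP=> [[t b] [_ _ /rcons_inj[]]].
- apply: allpairs_uniq; rewrite ?Nq_uniq // => -[s x] [t y] _ _ /=.
  move=> /rcons_inj E; have /= -> := congr1 fst E.
  by have /= /chr_inj -> := congr1 snd E.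
Qed.

Lemma mem_EseqSS n (s : seq entry) :
  reflect ((exists t b, t \in Eseq n.+1 /\ s = rcons t (bit b)) \/
           (exists t (chi : 'CF([set: 'rV[F]_n.+1]%G)),
              [/\ t \in Eseq n, chi \in Nq n.+1 & s = rcons t (chr chi)]))
          (s \in Eseq n.+2).
Proof.
rewrite EseqSS mem_cat; apply: (iffP orP).
- case=> [/allpairsP[[t b] [/= tE _ ->]]|/allpairsP[[t chi] [/= tE chiN ->]]].
    by left; exists t, b.
  by right; exists t, chi.
- case=> [[t [b [tE ->]]]|[t [chi [tE chiN ->]]]]; [left|right].
    by apply: allpairs_f => //; case: b.
  exact: allpairs_f.
Qed.

Lemma Nnz_le n s : s \in Eseq n -> (Nnz s <= n)%N.
Proof.
suff: (s \in Eseq n -> (Nnz s <= n)%N) /\ (s \in Eseq n.+1 -> (Nnz s <= n.+1)%N).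
  by case.
elim: n s => [|n IH] s.
  by split=> [|/=]; rewrite !inE; [move/eqP->|case/orP=> /eqP->].
have [_ IH1] := IH s; split=> // /mem_EseqSS[[t [b [tE ->]]]|[t [chi [tE _ ->]]]].
  rewrite /Nnz -cats1 count_cat /= addn0 -[n.+2]addn1.
  by rewrite leq_add ?leq_b1 //; case: (IH t) => _; apply.
rewrite /Nnz -cats1 count_cat /= addn0 -[n.+2]addn1.
by rewrite leq_add ?leq_b1 // leqW //; case: (IH t) => + _; apply.
Qed.

End Sequences.

(* Main.v *)
(** A_n is self-adjoint for the weight pi, hence has a pi-orthogonal eigenbasis;
    what remains is to match eigenvalue multiplicities with E_q(n).
    If f_Z denotes the indicator of [{X | X <= Z}] and k = dim Z, then
      A_n f_Z = (phi q^k - q^(n-k)) / (q-1) f_Z + sum of the f_W, W covering Z,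
    so A_n is triangular in the basis (f_Z), and its eigenvalue
    (phi q^(n-k) - q^k) / (q-1) has as multiplicity the number of subspaces of
    dimension n-k.  That number is a q-binomial coefficient (count flags), and
    the q-binomials satisfy the recurrence defining the sequences alpha with
    N(alpha) = k:
      [n+2, k+1] = [n+1, k+1] + [n+1, k] + (q^(n+1) - 1) [n, k]. *)

Require Import Defs.
From mathcomp Require Import all_boot all_order all_algebra all_fingroup.
From mathcomp Require Import all_field all_character spectral.
From mathcomp Require Import reals complex.
From mathcomp Require Import zify ring.

Import Order.TTheory GRing.Theory Num.Theory.
Local Open Scope ring_scope.
Local Open Scope complex_scope.

Set Implicit Arguments.
Unset Strict Implicit.
Unset Printing Implicit Defensive.

(** * The covering relation of the subspace lattice: duality and cover counts *)

Section Subspaces.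
Variables (F : finFieldType) (n : nat).
Implicit Types X Y Z : Bq F n.

Definition covers X Y := (X <= Y)%VS && (\dim Y == (\dim X).+1).

Lemma dim_addv_line X v : v \notin X -> \dim (X + <[v]>) = (\dim X).+1.
Proof.
move=> vX; apply/eqP; rewrite eqn_leq; apply/andP; split.
  have [/leq_trans -> //] := dimv_add_leqif X <[v]>%VS.
  by rewrite dim_vline -(addn1 (\dim X)) leq_add2l leq_b1.
by rewrite (ltn_leqif (dimv_leqif_sup (addvSl X _))) subv_add subvv -memvE.
Qed.

(** Double count of the pairs of a cover [Y] and a vector [v] of [Y] outside [X]: each [v] in [Z]
    outside [X] lies in exactly one cover of [X], namely [X + <[v]>]. *)
Lemma card_covers X Z : (X <= Z)%VS ->
  (#|[pred Y | covers X Y && (Y <= Z)%VS]| * (#|F| ^ (\dim X).+1 - #|F| ^ \dim X)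
   = #|F| ^ \dim Z - #|F| ^ \dim X)%N.
Proof.
move=> sXZ.
have cardD Y : (X <= Y)%VS -> #|[pred v | (v \in Y) && (v \notin X)]|
    = (#|F| ^ \dim Y - #|F| ^ \dim X)%N.
  move=> sXY; rewrite -!card_vspace.
  rewrite -(cardID (mem X) (mem Y)) (_ : #|[predI mem Y & mem X]| = #|X|).
    by rewrite addKn; apply: eq_card => v; rewrite !inE andbC.
  apply: eq_card => v; rewrite !inE andbC.
  by case: (boolP (v \in X)) => //= /(subvP sXY).
rewrite -(cardD Z sXZ) -[X in (X * _)%N]sum1_card big_distrl /=.
transitivity (\sum_(Y | covers X Y && (Y <= Z)%VS)
                #|[pred v | (v \in Y) && (v \notin X)]|)%N.
  apply: eq_bigr => Y /andP[/andP[sXY /eqP dY] _].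
  by rewrite cardD // dY mul1n.
under eq_bigr => Y _ do rewrite -sum1_card.
rewrite (exchange_big_dep [pred v | (v \in Z) && (v \notin X)]) /=; last first.
  by move=> Y v /andP[_ /subvP sYZ] /andP[/sYZ-> ->].
rewrite -sum1_card; apply: eq_bigr => v /andP[vZ vX].
rewrite (big_pred1 (X + <[v]>)%VS) // => Y /=.
apply/idP/eqP => [/andP[/andP[/andP[sXY /eqP dY] _] /andP[vY _]]|->].
  by apply/eqP; rewrite eq_sym eqEdim subv_add sXY -memvE vY /= dY dim_addv_line.
rewrite /covers addvSl dim_addv_line // eqxx subv_add sXZ -memvE vZ /=.
by rewrite inE vX andbT memvE addvSr.
Qed.

Import VectorInternalTheory.

(** The orthogonal complement for the standard bilinear form. As an order-reversing involution it
    turns counts of covers above into counts of covers below. *)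
Definition perp X : Bq F n := mx2vs (kermx (vs2mx X)^T).

Lemma dim_rV : \dim {: 'rV[F]_n} = n.
Proof. by rewrite dimvf dim_matrix; exact: mul1n. Qed.

Lemma dim_Bq X : (\dim X <= n)%N.
Proof. by rewrite -[X in (_ <= X)%N]dim_rV dimvS ?subvf. Qed.

Lemma dim_perp X : \dim (perp X) = (n - \dim X)%N.
Proof.
by rewrite /dimv mx2vsK mxrank_ker mxrank_tr -[X in (X - _)%N]dimvf dim_rV.
Qed.

Lemma perpS X Y : (X <= Y)%VS -> (perp Y <= perp X)%VS.
Proof.
rewrite /subsetv !mx2vsK => /submxP[D ->]; apply/sub_kermxP.
by rewrite trmx_mul mulmxA mulmx_ker mul0mx.
Qed.

(** Transposing the kernel equation gives [X <= perp (perp X)]; equality follows from dimensions, so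
    isotropic vectors do no harm. *)
Lemma perpK : involutive perp.
Proof.
move=> X; apply/eqP; rewrite eq_sym eqEdim !dim_perp subKn ?dim_Bq // leqnn andbT.
rewrite /subsetv mx2vsK; apply/sub_kermxP/trmx_inj; rewrite trmx_mul trmxK trmx0.
by apply/sub_kermxP; rewrite mx2vsK.
Qed.

Lemma covers_perp X Y : covers (perp X) (perp Y) = covers Y X.
Proof.
have dX := dim_Bq X; have dY := dim_Bq Y.
apply/andP/andP => -[]; rewrite !dim_perp => sYX /eqP d; split.
- by rewrite -[Y]perpK -[X]perpK perpS.
- by apply/eqP; lia.
- exact: perpS.
- by apply/eqP; lia.
Qed.

Lemma covers_addv X Z : covers Z (X + Z)%VS = covers (X :&: Z)%VS X.
Proof.
rewrite /covers addvSr capvSl /=; have := dimv_sum_cap X Z; lia.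
Qed.

Variable R : numFieldType.
Local Notation q := (#|F|%:R : R).

Lemma card_field_gt1 : 1 < q.
Proof. by rewrite ltr1n finNzRing_gt1. Qed.

Lemma card_coversR X Z : (X <= Z)%VS ->
  #|[pred Y | covers X Y && (Y <= Z)%VS]|%:R
    = (q ^+ (\dim Z - \dim X) - 1) / (q - 1).
Proof.
move=> sXZ; have q1 := card_field_gt1; have sd := dimvS sXZ.
have q0 : q != 0 by rewrite gt_eqF // (lt_trans _ q1).
have F0 : (0 < #|F|)%N by rewrite -(ltr_nat R) (lt_trans _ q1).
have /(congr1 (fun m => m%:R : R)) := card_covers sXZ.
rewrite natrM !natrB ?leq_pexp2l // !natrX => e.
apply/(canRL (mulfK _)); first by rewrite subr_eq0 gt_eqF.
have qX : q ^+ \dim X != 0 by rewrite expf_neq0.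
apply: (mulIf qX); rewrite mulrBl -exprD subnK // mul1r -e exprS; ring.
Qed.

Lemma card_covers_above X :
  #|[pred Y | covers X Y]|%:R = (q ^+ (n - \dim X) - 1) / (q - 1).
Proof.
rewrite -[X in (X - _)%N]dim_rV -card_coversR ?subvf //.
by congr _%:R; apply: eq_card => Y; rewrite !inE subvf andbT.
Qed.

Lemma card_covers_below X :
  #|[pred Y | covers Y X]|%:R = (q ^+ \dim X - 1) / (q - 1).
Proof.
rewrite -[X in q ^+ X](subKn (dim_Bq X)) -dim_perp -card_covers_above.
rewrite -(card_image (can_inj perpK)); congr _%:R; apply: eq_card => Y /=.
by rewrite -[Y]perpK (mem_image (can_inj perpK)) !inE covers_perp.
Qed.

End Subspaces.

(** * Gaussian binomials count both subspaces and sequences *)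

Section Counting.
Variables (R : numFieldType) (F : finFieldType).
Local Notation q := (#|F|%:R : R).

Lemma expq_neq1 k : (0 < k)%N -> q ^+ k - 1 != 0.
Proof. by move=> k0; rewrite subr_eq0 gt_eqF // exprn_egt1 ?card_field_gt1 -?lt0n. Qed.

(** The Gaussian binomial coefficient. For [n < k] the factor at [j = n] vanishes, so the formula is
    right there too, despite truncated subtraction. *)
Definition qbinom n k : R := \prod_(j < k) ((q ^+ (n - j) - 1) / (q ^+ j.+1 - 1)).

Lemma qbinom0 n : qbinom n 0 = 1. Proof. exact: big_ord0. Qed.

Lemma qbinomS n k :
  qbinom n k.+1 = qbinom n k * ((q ^+ (n - k) - 1) / (q ^+ k.+1 - 1)).
Proof. exact: big_ord_recr. Qed.

Lemma qbinom_absorb n k :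
  qbinom n.+1 k.+1 = qbinom n k * ((q ^+ n.+1 - 1) / (q ^+ k.+1 - 1)).
Proof.
elim: k => [|k IH]; first by rewrite qbinomS !qbinom0.
by rewrite qbinomS IH (qbinomS n) subSS; ring.
Qed.

Lemma qbinom_small n k : (n < k)%N -> qbinom n k = 0.
Proof.
move=> lt_nk; apply/eqP/prodf_eq0; exists (Ordinal lt_nk) => //=.
by rewrite subnn subrr mul0r.
Qed.

(** Absorption rewrites the last term as (q^(k+1) - 1) [n+1, k+1], which merges with the first one
    into q^(k+1) [n+1, k+1]; what is left is the q-Pascal rule. *)
Lemma qbinom_rec n k : qbinom n.+2 k.+1 =
  qbinom n.+1 k.+1 + qbinom n.+1 k + (q ^+ n.+1 - 1) * qbinom n k.
Proof.
have qk := expq_neq1 (ltn0Sn k).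
have -> : (q ^+ n.+1 - 1) * qbinom n k = (q ^+ k.+1 - 1) * qbinom n.+1 k.+1.
  by rewrite qbinom_absorb; field.
rewrite qbinom_absorb qbinomS.
(* The splitting of q^(n+2) below needs [k <= n.+1]; beyond that every term is 0. *)
have [le_kn|lt_nk] := leqP k n.+1; last by rewrite qbinom_small // !mul0r mulr0 !addr0.
have -> : q ^+ n.+2 = q ^+ (n.+1 - k) * q ^+ k.+1.
  by rewrite -exprD; congr (_ ^+ _); lia.
by field.
Qed.

Definition nb_subspaces n k := #|[pred X : Bq F n | \dim X == k]|.

(** Up to the common factor q - 1, both sides count the pairs [covers X Y] with [\dim X = k],
    grouped by [X] on the left and by [Y] on the right. *)
Lemma nb_subspaces_flags n k :
  (nb_subspaces n k)%:R * (q ^+ (n - k) - 1)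
    = (nb_subspaces n k.+1)%:R * (q ^+ k.+1 - 1).
Proof.
have q1 : q - 1 != 0 by have := expq_neq1 (ltn0Sn 0).
suff: (nb_subspaces n k)%:R * ((q ^+ (n - k) - 1) / (q - 1))
    = (nb_subspaces n k.+1)%:R * ((q ^+ k.+1 - 1) / (q - 1)).
  by rewrite !mulrA => /(mulIf _); apply; rewrite invr_eq0.
rewrite /nb_subspaces -(sum1_card [pred X : Bq F n | \dim X == k]).
rewrite -(sum1_card [pred X : Bq F n | \dim X == k.+1]) !natr_sum !mulr_suml.
transitivity (\sum_(X : Bq F n | \dim X == k) #|[pred Y | covers X Y]|%:R : R).
  by apply: eq_big => // X /eqP dX; rewrite card_covers_above dX mul1r.
transitivity (\sum_(Y : Bq F n | \dim Y == k.+1) #|[pred X | covers X Y]|%:R : R).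
  2: by apply: eq_big => // X /eqP dX; rewrite card_covers_below dX mul1r.
under eq_bigr do rewrite -sum1_card natr_sum.
under [in RHS]eq_bigr do rewrite -sum1_card natr_sum.
rewrite (exchange_big_dep (fun Y : Bq F n => \dim Y == k.+1)) /=.
  apply: eq_bigr => Y /eqP dY; apply: eq_bigl => X.
  by rewrite !inE /covers dY eqSS [k == _]eq_sym andbA andbC andbA andbb andbC.
by move=> X Y /eqP <- /andP[].
Qed.

Lemma nb_subspacesE n k : (nb_subspaces n k)%:R = qbinom n k.
Proof.
elim: k => [|k IH].
  rewrite qbinom0; suff -> : nb_subspaces n 0 = 1%N by [].
  by rewrite -[RHS](card1 (0%VS : Bq F n)); apply: eq_card => X; rewrite !inE dimv_eq0.
apply: (mulIf (expq_neq1 (ltn0Sn k))); rewrite -nb_subspaces_flags IH qbinomS.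
by rewrite mulrA mulfVK ?expq_neq1.
Qed.

(** An abelian group has as many irreducible characters as elements; the predecessor accounts for
    the trivial one. *)
Lemma size_Nq m : size (Nq F m) = (#|F| ^ m).-1.
Proof.
set G := [set: 'rV[F]_m]%G.
have sG : size (irr G) = #|G|.
  rewrite size_tuple NirrE; apply/eqP; rewrite -card_classes_abelian.
  by apply/centsP => x _ y _; exact: addrC.
have := count_predC (pred1 1) (irr G).
rewrite count_uniq_mem ?cfun1_irr ?sG; last exact: free_uniq (irr_free _).
by rewrite cardsT card_mx mul1n /Nq size_filter => <-.
Qed.

Definition nb_sequences n k := count (fun s => Nnz s == k) (Eseq F n).

Lemma Nnz_rcons_bit (s : seq (entry F)) b : Nnz (rcons s (bit F b)) = (Nnz s + b)%N.
Proof. by rewrite /Nnz -cats1 count_cat /= addn0; case: b. Qed.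

Lemma Nnz_rcons_chr (s : seq (entry F)) m (chi : 'CF([set: 'rV[F]_m]%G)) :
  Nnz (rcons s (chr chi)) = (Nnz s).+1.
Proof. by rewrite /Nnz -cats1 count_cat /= addn0 addn1. Qed.

Lemma count_allpairs (S T U : Type) (f : S -> T -> U) (a : pred U) s t :
  count a [seq f x y | x <- s, y <- t] = (\sum_(x <- s) count (fun y => a (f x y)) t)%N.
Proof.
elim: s => [|x s IH]; first by rewrite big_nil.
by rewrite /= count_cat IH big_cons count_map.
Qed.

Lemma nb_sequences0 n : nb_sequences n.+2 0 = nb_sequences n.+1 0.
Proof.
rewrite /nb_sequences EseqSS count_cat !count_allpairs [X in (_ + X)%N]big1 ?addn0.
  rewrite -sum1_count [RHS]big_mkcond; apply: eq_bigr => s _ /=.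
  by rewrite !Nnz_rcons_bit addn1 !addn0; case: (_ == _).
by move=> s _; rewrite (eq_count (a2 := pred0)) ?count_pred0 // => chi; rewrite Nnz_rcons_chr.
Qed.

(** The three terms correspond to a last entry equal to 0, to 1, or to a nontrivial character. *)
Lemma nb_sequencesS n k : nb_sequences n.+2 k.+1 =
  (nb_sequences n.+1 k.+1 + nb_sequences n.+1 k + (#|F| ^ n.+1).-1 * nb_sequences n k)%N.
Proof.
rewrite /nb_sequences EseqSS count_cat !count_allpairs; congr (_ + _)%N.
  rewrite -!sum1_count [X in (_ = X + _)%N]big_mkcond [X in (_ = _ + X)%N]big_mkcond.
  rewrite -big_split.
  apply: eq_bigr => s _ /=.
  by rewrite !Nnz_rcons_bit addn1 !addn0 eqSS; do 2 case: (_ == _).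
rewrite -sum1_count big_distrr [RHS]big_mkcond; apply: eq_bigr => s _ /=.
under eq_count => chi do rewrite Nnz_rcons_chr eqSS.
by case: (_ == _); rewrite ?count_predT ?count_pred0 // size_Nq muln1.
Qed.

Lemma nb_sequencesE n k : (nb_sequences n k)%:R = qbinom n k.
Proof.
suff: (forall k, (nb_sequences n k)%:R = qbinom n k) /\
      (forall k, (nb_sequences n.+1 k)%:R = qbinom n.+1 k) by case.
elim: n {k} => [|n [IH0 IH1]].
  split=> -[|k]; rewrite ?qbinom0 //.
    by rewrite qbinom_small.
  case: k => [|k]; last by rewrite qbinom_small.
  by rewrite qbinomS qbinom0 mul1r divff // expq_neq1.
split=> // -[|k]; first by rewrite nb_sequences0 IH1 !qbinom0.
rewrite nb_sequencesS qbinom_rec !natrD natrM !IH1 IH0 -subn1 natrB ?natrX //.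
by rewrite expn_gt0 (ltnW (finNzRing_gt1 F)).
Qed.

End Counting.

(** Each [k] has multiplicity [n, k] on both sides, since [perp] exchanges dimension and
    codimension. Codimension is used because it is the index of the eigenvalue attached to a
    subspace. *)
Lemma perm_Nnz_dim (F : finFieldType) n :
  perm_eq [seq Nnz s | s <- Eseq F n] [seq (n - \dim X)%N | X <- index_enum {: Bq F n}].
Proof.
apply/allP => k _; apply/eqP; rewrite !count_map -[RHS]sum1_count sum1_card.
transitivity (nb_subspaces F n k).
  (* Gaussian binomials are defined by division, so the two counts are compared in a field; [rat]
     suffices. *)
  by apply/eqP; rewrite -(eqr_nat rat) nb_subspacesE nb_sequencesE.
rewrite /nb_subspaces -(card_image (can_inj (@perpK F n))); apply: eq_card => X.
rewrite -[X]perpK (mem_image (can_inj (@perpK F n))) perpK inE /=.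
by rewrite -[X in \dim X == k]perpK dim_perp.
Qed.

(** * Linear algebra: triangularity by height, intertwining and matching of multisets *)

Section HeightTriangular.
Variables (N : nat) (h : 'I_N -> nat).

(** Triangularity is expressed by a height function, so that matrices indexed by subspaces can be
    graded by dimension without sorting the indices. *)
Lemma det_height (R : comNzRingType) (A : 'M[R]_N) :
  (forall i j, A i j != 0 -> i = j \/ (h i < h j)%N) -> \det A = \prod_i A i i.
Proof.
move=> hA; rewrite /determinant (bigD1 1%g) //= odd_perm1 mul1r.
rewrite [X in _ + X]big1 ?addr0 => [|s s_neq1].
  by apply: eq_bigr => i _; rewrite perm1.
have [/forallP nz|] := boolP [forall i, A i (s i) != 0]; last first.
  rewrite negb_forall => /existsP[i /negPn/eqP Ai0].
  by rewrite (bigD1 i) //= Ai0 mul0r mulr0.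
(* A permutation preserves the total height, so it cannot raise any height. *)
have : (\sum_i (h i + (s i != i)) <= \sum_i h (s i))%N.
  apply: leq_sum => i _; case: (hA _ _ (nz i)) => [<-|lt_h]; first by rewrite eqxx addn0.
  by case: eqP => _; rewrite ?addn0 ?addn1 // ltnW.
rewrite [X in (_ <= X)%N](_ : _ = \sum_i h i)%N; last by rewrite [RHS](reindex_perm s).
rewrite big_split /= -[X in (_ <= X)%N]addn0 leq_add2l leqn0 sum_nat_eq0 => /forallP s1.
case/eqP: s_neq1; apply/permP => i; rewrite perm1; apply/eqP.
by have := s1 i; rewrite eqb0 negbK.
Qed.

Lemma char_poly_height (R : comNzRingType) (A : 'M[R]_N) :
  (forall i j, A i j != 0 -> i = j \/ (h i < h j)%N) ->
  char_poly A = \prod_i ('X - (A i i)%:P).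
Proof.
move=> hA; rewrite /char_poly det_height => [|i j].
  by apply: eq_bigr => i _; rewrite !mxE eqxx.
rewrite !mxE; have [->|_] := eqVneq i j; first by left.
rewrite mulr0n sub0r oppr_eq0 polyC_eq0; exact: hA.
Qed.

End HeightTriangular.

(** The relation lifts to (X - A) U = U (X - B) over polynomials; after taking determinants the
    nonzero factor det U cancels, so no inverse of [U] is needed. *)
Lemma char_poly_intertwine (R : idomainType) N (A B U : 'M[R]_N) :
  A *m U = U *m B -> \det U != 0 -> char_poly A = char_poly B.
Proof.
move=> AU detU.
have detUX : \det (map_mx polyC U) != 0 by rewrite det_map_mx polyC_eq0.
apply: (mulIf detUX); rewrite [RHS]mulrC /char_poly -!det_mulmx; congr (\det _).
by rewrite /char_poly_mx mulmxBl mulmxBr -!map_mxM /= AU scalar_mxC.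
Qed.

Lemma basis_col (K : fieldType) N (U : 'M[K]_N) : U \in unitmx ->
  basis_of fullv [seq col k U | k <- index_enum 'I_N].
Proof.
move=> Uu; rewrite basisEdim size_map -sum1_size (eq_bigl (mem 'I_N)) // sum1_card card_ord.
rewrite dimvf dim_matrix (leq_trans _ (eq_leq (esym (muln1 N)))) // andbT; apply/subvP => w _.
rewrite -(mulKVmx Uu w) (_ : U *m _ = \sum_k (invmx U *m w) k 0 *: col k U).
  apply: memv_suml => k _; rewrite memvZ // memv_span //.
  exact/(map_f (fun k => col k U))/mem_index_enum.
apply/matrixP => i j; rewrite ord1 summxE mxE; apply: eq_bigr => k _.
by rewrite !mxE mulrC.
Qed.

(** Greedy matching: the head [x] takes some [y] in [t] with [g y = f x], and removing both keeps
    the value multisets equal. Uniqueness of [s] ensures that setting the value at [x] disturbs no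
    other element; [y0] is the value outside [s]. *)
Lemma perm_map_factor (S T V : eqType) (f : S -> V) (g : T -> V) (y0 : T) s t :
    uniq s -> perm_eq (map f s) (map g t) ->
  exists h : S -> T, perm_eq (map h s) t /\ {in s, forall x, g (h x) = f x}.
Proof.
elim: s t => [|x s IH] t /=.
  by move=> _ /perm_size /esym /eqP; rewrite size_map size_eq0 => /eqP ->; exists (fun=> y0).
case/andP=> xs us pe.
have : f x \in map g t by rewrite -(perm_mem pe) mem_head.
case/mapP=> y yt fx; have pt := perm_to_rem yt.
have /(IH _ us)[h [ph hs]] : perm_eq (map f s) (map g (rem y t)).
  rewrite -(perm_cons (f x)) (perm_trans pe) // fx -map_cons; exact: perm_map.
exists (fun z => if z == x then y else h z); split=> [|z].
  have -> : [seq if z == x then y else h z | z <- s] = map h s.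
    by apply/eq_in_map => z zs; case: eqP => // zx; rewrite -zx zs in xs.
  rewrite eqxx; apply: (perm_trans (y := y :: rem y t)); last by rewrite perm_sym.
  by rewrite perm_cons.
by rewrite inE; case: eqP => [->|_] //= zs; exact: hs.
Qed.

Lemma uniq_map_inj_in (S T : eqType) (h : S -> T) s :
  uniq (map h s) -> {in s &, injective h}.
Proof.
elim: s => [|x s IH] //= /andP[hx /IH inj] y z.
rewrite !inE => /predU1P[->|ys] /predU1P[->|zs] // e; last exact: inj.
  by rewrite e map_f in hx.
by rewrite -e map_f in hx.
Qed.

(** * The spectral theorem for a weighted inner product *)

Section WeightedSpectral.
Variables (C : numClosedFieldType) (N : nat) (A : 'M[C]_N) (p : 'I_N -> C).
Hypothesis p_gt0 : forall i, 0 < p i.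
Hypothesis A_sym : forall i j, p i * A i j = p j * (A j i)^*.

(* Conjugating by diag(sqrt p) turns A into a hermitian matrix. *)
Lemma weighted_spectral : exists (U : 'M[C]_N) (d : 'rV[C]_N),
  [/\ U \in unitmx, A *m U = U *m diag_mx d &
      forall k l, \sum_i (U i k)^* * U i l * p i = (k == l)%:R].
Proof.
pose s i := sqrtC (p i); pose D := diag_mx (\row_i s i) : 'M[C]_N.
have s_gt0 i : 0 < s i by rewrite sqrtC_gt0.
have s_neq0 i : s i != 0 by rewrite gt_eqF.
have ss i : s i * s i = p i by rewrite -expr2 sqrtCK.
have sJ i : (s i)^*%R = s i by rewrite geC0_conj // ltW.
have Du : D \in unitmx.
  by rewrite unitmxE det_diag unitfE; apply/prodf_neq0 => i _; rewrite mxE.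
pose S := \matrix_(i, j) (s i * A i j / s j).
have SD : S *m D = D *m A.
  by apply/matrixP => i j; rewrite mul_mx_diag mul_diag_mx !mxE mulfVK.
have SJ : map_mx Num.conj S^T = S.
  apply/matrixP => i j; rewrite !mxE !rmorphM fmorphV /= !sJ.
  apply/(mulIf (s_neq0 i))/(mulIf (s_neq0 j)); rewrite mulfVK //.
  by rewrite [LHS]mulrAC ss -A_sym -(ss i); field.
set P := spectralmx S; set d := spectral_diag S.
have /orthomx_spectralP : S \is normalmx by apply/normalmxP; rewrite SJ.
rewrite -/P -/d => eS.
have Pu : P \in unitmx := spectral_unit S.
(* The columns of [invmx P] are orthonormal eigenvectors of [S = D A D^-1]; [invmx D] carries them
   to eigenvectors of [A]. *)
exists (invmx D *m invmx P), d; split.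
- by rewrite unitmx_mul !unitmx_inv Du.
- have -> : A = invmx D *m S *m D by rewrite -mulmxA SD mulKmx.
  by rewrite !mulmxA mulmxK // eS !mulmxA mulmxK.
move=> k l; set U := _ *m _.
(* As [P] is unitary, [D *m U] is its adjoint. Since [p i = s i * s i], the weighted product of
   columns of [U] is thus the standard product of rows of [P]. *)
have sU i j : s i * U i j = (P j i)^*%R.
  have <- : (D *m U) i j = s i * U i j by rewrite mul_diag_mx !mxE.
  by rewrite mulKVmx // invmx_unitary ?spectral_unitarymx // !mxE.
have <- : \sum_i P k i * (P l i)^*%R = (k == l)%:R.
  have /unitarymxP/matrixP/(_ k l) := spectral_unitarymx S.
  by rewrite !mxE => <-; apply: eq_bigr => i _; rewrite !mxE.
apply: eq_bigr => i _; rewrite -sU -[P k i]conjCK -sU rmorphM /= sJ -ss; ring.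
Qed.

End WeightedSpectral.

(** * Self-adjointness and characteristic polynomial of A_n *)

Section Eigenvalues.
Variables (R : realType) (F : finFieldType) (phi : R) (n : nat).
Implicit Types X Y Z W : Bq F n.
Local Notation q := (#|F|%:R : R).

Definition eigval k : R := (phi * q ^+ (n - k) - q ^+ k) / (q - 1).

Lemma covers_neq X Y : covers X Y -> (X == Y) = false.
Proof. by move=> /andP[_ /eqP d]; apply/eqP => e; rewrite e in d; lia. Qed.

Lemma covers_asym X Y : covers X Y -> covers Y X = false.
Proof. by rewrite /covers => /andP[_ /eqP ->]; apply/negP => /andP[_ /eqP]; lia. Qed.

Lemma A_entryE X Y : A_entry phi X Y =
  (covers Y X)%:R + phi * q ^+ \dim X * (covers X Y)%:R
  + (phi - 1) / (q - 1) * q ^+ \dim X * (X == Y)%:R.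
Proof.
rewrite /A_entry -/(covers Y X) -/(covers X Y).
case: (boolP (covers Y X)) => [cYX|_].
  by rewrite (covers_asym cYX) eq_sym (covers_neq cYX) !mulr0 !addr0.
case: (boolP (covers X Y)) => [cXY|_].
  by rewrite (covers_neq cXY) mulr1 mulr0 add0r addr0.
by case: (X == Y); rewrite ?mulr0 ?mulr1 ?add0r ?addr0.
Qed.

Lemma pi_weight_gt0 X : 0 < phi -> 0 < pi_weight phi X.
Proof.
move=> phi_gt0; have q_gt0 : 0 < q by rewrite ltr0n (ltnW (finNzRing_gt1 F)).
rewrite /pi_weight /Pq divr_gt0 ?mulr_gt0 ?exprn_gt0 //.
by apply: prodr_gt0 => j _; rewrite addr_gt0 ?ltr01 // mulr_gt0 // exprn_gt0.
Qed.

(** From C(k+1, 2) = C(k, 2) + k. The ratio of weights along a cover is exactly the entry of A_n at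
    (X, Y), while the entry at (Y, X) is 1: this is detailed balance, which makes A_n
    self-adjoint. *)
Lemma pi_weight_covers X Y :
  covers X Y -> pi_weight phi Y = phi * q ^+ \dim X * pi_weight phi X.
Proof. by case/andP=> _ /eqP d; rewrite /pi_weight d binS bin1 exprS exprD; ring. Qed.

Lemma A_entry_sym X Y :
  pi_weight phi X * A_entry phi X Y = pi_weight phi Y * A_entry phi Y X.
Proof.
rewrite !A_entryE; case: (boolP (covers X Y)) => [cXY|_].
  rewrite (covers_asym cXY) (pi_weight_covers cXY) (eq_sym Y X) (covers_neq cXY) /=; ring.
case: (boolP (covers Y X)) => [cYX|_].
  rewrite (pi_weight_covers cYX) (eq_sym X Y) (covers_neq cYX) /=; ring.
by case: (eqVneq X Y) => [->|_] //=; rewrite !mulr0 !addr0 !mulr0.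
Qed.

(** A hyperplane of [X] inside [Z] lies in [X :&: Z], a proper subspace of [X], hence equals it.
    [covers_sup_add] is the dual fact. *)
Lemma covers_sub_cap X Y Z : ~~ (X <= Z)%VS ->
  covers Y X && (Y <= Z)%VS = (Y == X :&: Z)%VS && covers (X :&: Z)%VS X.
Proof.
move=> nXZ; apply/andP/andP => [[/andP[sYX /eqP dX] sYZ]|[/eqP-> ->]]; last first.
  by rewrite capvSr.
suff eY : (Y == X :&: Z)%VS by rewrite eY -(eqP eY) /covers sYX dX eqxx.
rewrite eqEdim subv_cap sYX sYZ /= -ltnS -dX.
by rewrite (ltn_leqif (dimv_leqif_sup (capvSl X Z))) subv_cap subvv.
Qed.

Lemma covers_sup_add X Z W : ~~ (X <= Z)%VS ->
  covers Z W && (X <= W)%VS = (W == X + Z)%VS && covers Z (X + Z)%VS.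
Proof.
move=> nXZ; apply/andP/andP => [[/andP[sZW /eqP dW] sXW]|[/eqP-> ->]]; last first.
  by rewrite addvSl.
suff eW : (W == X + Z)%VS by rewrite eW -(eqP eW) /covers sZW dW eqxx.
rewrite eq_sym eqEdim subv_add sXW sZW /= dW.
by rewrite (ltn_leqif (dimv_leqif_sup (addvSr X Z))) subv_add subvv andbT.
Qed.

Lemma card_pred1_and (T : finType) (P : pred T) x b :
  (forall y, P y = (y == x) && b) -> #|P|%:R = b%:R :> R.
Proof.
move=> hP; rewrite -sum1_card natr_sum (eq_bigl (fun y => (y == x) && b)) //.
by case: b {hP} => /=; [under eq_bigl do rewrite andbT; rewrite big_pred1_eq
                      | rewrite big_pred0 // => y; rewrite andbF].
Qed.

Lemma sumr_mul_pred (T : finType) (P Q : pred T) :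
  \sum_x (P x)%:R * (Q x)%:R = #|[pred x | P x && Q x]|%:R :> R.
Proof.
rewrite -sum1_card natr_sum [RHS]big_mkcond; apply: eq_bigr => x _.
by rewrite inE -natrM mulnb; case: (_ && _).
Qed.

(** If [X <= Z], the cover counts make both sides (phi q^(dim Z) - 1) / (q - 1). Otherwise only
    [Y = X :&: Z] and [W = X + Z] can contribute, and they do so simultaneously by modularity
    ([covers_addv]). *)
Lemma A_entry_zeta X Z :
  \sum_Y A_entry phi X Y * (Y <= Z)%VS%:R =
  (X <= Z)%VS%:R * eigval (n - \dim Z) + \sum_W (X <= W)%VS%:R * (covers Z W)%:R.
Proof.
have q1 : q - 1 != 0 := expq_neq1 R F (ltn0Sn 0).
transitivity (#|[pred Y | covers Y X && (Y <= Z)%VS]|%:R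
    + phi * q ^+ \dim X * #|[pred Y | covers X Y && (Y <= Z)%VS]|%:R
    + (phi - 1) / (q - 1) * q ^+ \dim X * (X <= Z)%VS%:R).
  set c := (_ - 1) / _ * _.
  under eq_bigr => Y _ do
    rewrite A_entryE (mulrDl (_ + _)) mulrDl -/c -[_ * _ * _]mulrA -[c * _ * _]mulrA.
  rewrite !big_split /= -!sumr_mul_pred -!mulr_sumr; congr (_ + _ + _ * _).
  rewrite (bigD1 X) //= eqxx mul1r big1 ?addr0 // => Y /negPf.
  by rewrite eq_sym => ->; rewrite mul0r.
under [in RHS]eq_bigr do rewrite mulrC.
rewrite sumr_mul_pred /=; case: (boolP (X <= Z)%VS) => [sXZ|nXZ]; last first.
  rewrite mul0r mulr0 addr0 add0r.
  rewrite (card_pred1_and (fun Y => covers_sub_cap Y nXZ)).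
  rewrite (card_pred1_and (fun W => covers_sup_add W nXZ)).
  rewrite (_ : #|[pred Y | covers X Y && (Y <= Z)%VS]| = 0%N) ?mulr0 ?addr0; last first.
    apply: eq_card0 => Y; rewrite !inE; apply/negP => /andP[/andP[sXY _] sYZ].
    by case/negP: nXZ; apply: subv_trans sYZ.
  by rewrite covers_addv.
rewrite card_coversR // mulr1 mul1r.
rewrite (_ : #|[pred Y | covers Y X && (Y <= Z)%VS]| = #|[pred Y | covers Y X]|); last first.
  apply: eq_card => Y; rewrite !inE; case: (boolP (covers Y X)) => //= /andP[sYX _].
  exact: subv_trans sXZ.
rewrite (_ : #|[pred W | covers Z W && (X <= W)%VS]| = #|[pred W | covers Z W]|); last first.
  apply: eq_card => Y; rewrite !inE; case: (boolP (covers Z Y)) => //= /andP[sZY _].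
  exact: subv_trans sZY.
rewrite card_covers_below card_covers_above /eigval subKn ?dim_Bq //.
have -> : q ^+ \dim Z = q ^+ \dim X * q ^+ (\dim Z - \dim X).
  by rewrite -exprD subnKC // dimvS.
by field.
Qed.

Let AR : 'M[R]_#|{: Bq F n}| := \matrix_(i, j) A_entry phi (enum_val i) (enum_val j).

Lemma char_poly_A_entry : char_poly AR = \prod_(X : Bq F n) ('X - (eigval (n - \dim X))%:P).
Proof.
(* The columns of [Z] are the indicators of the down-sets; [T] is the matrix of A_n in that
   basis. *)
pose Z : 'M[R]_#|{: Bq F n}| := \matrix_(i, j) (enum_val i <= enum_val j)%VS%:R.
pose T : 'M[R]_#|{: Bq F n}| := \matrix_(i, j)
  ((i == j)%:R * eigval (n - \dim (enum_val j)) + (covers (enum_val j) (enum_val i))%:R).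
have AZ : AR *m Z = Z *m T.
  apply/matrixP => i j; rewrite !mxE.
  under eq_bigr do rewrite !mxE; under [RHS]eq_bigr do rewrite !mxE mulrDr.
  rewrite big_split /= [X in _ = X + _](bigD1 j) //= eqxx mul1r.
  rewrite [X in _ + X + _]big1 ?addr0; last first.
    by move=> k /negPf ->; rewrite mul0r mulr0.
  rewrite -(big_enum_val (A := predT)
    (fun Y => A_entry phi (enum_val i) Y * (Y <= enum_val j)%VS%:R)).
  rewrite -(big_enum_val (A := predT)
    (fun W => (enum_val i <= W)%VS%:R * (covers (enum_val j) W)%:R)).
  exact: A_entry_zeta.
have detZ : \det Z != 0.
  rewrite (det_height (h := fun i => \dim (enum_val i))).
    by rewrite big1 ?oner_neq0 // => i _; rewrite mxE subvv.
  move=> i j; rewrite mxE pnatr_eq0 eqb0 negbK => sij.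
  have [eij|neij] := eqVneq (enum_val i) (enum_val j); first by left; apply: enum_val_inj.
  by right; rewrite (ltn_leqif (dimv_leqif_eq sij)) neij.
rewrite (char_poly_intertwine AZ detZ).
(* Off the diagonal, [T] is nonzero only where the row subspace covers the column subspace, so the
   height that increases is the codimension. *)
rewrite (char_poly_height (h := fun i => n - \dim (enum_val i))%N).
  rewrite [RHS](reindex _ (onW_bij _ (@enum_val_bij (Bq F n)))) /=.
  apply: eq_bigr => i _; rewrite mxE eqxx mul1r.
  by rewrite /covers ltn_eqF ?andbF ?addr0.
move=> i j; rewrite mxE; case: (eqVneq i j) => [->|_]; first by left.
rewrite mul0r add0r pnatr_eq0 eqb0 negbK => /andP[_ /eqP d]; right.
by have := dim_Bq (enum_val i); lia.
Qed.

End Eigenvalues.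

(** * Labelling an orthonormal eigenbasis by sequences *)

Theorem theorem1p3 (R : realType) (q : nat) (F : finFieldType)
    (hF : #|F| = q) (n : nat) (phi : R) (hphi : 0 < phi) :
  exists v : seq (entry F) -> 'cV[R[i]]_#|{: Bq F n}|,
    [/\ forall alpha : seq (entry F), alpha \in Eseq F n ->
          A_mx F phi n *m v alpha =
            ((phi * q%:R ^+ (n - Nnz alpha) - q%:R ^+ Nnz alpha) / (q%:R - 1))%:C *: v alpha,
        basis_of fullv [seq v alpha | alpha <- Eseq F n]
      & forall alpha beta : seq (entry F),
          alpha \in Eseq F n -> beta \in Eseq F n -> alpha <> beta ->
          dot_pi phi (v alpha) (v beta) = 0].
Proof.
have [|i j|U [d [Uu AU orthU]]] := @weighted_spectral R[i] _ (A_mx F phi n)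
    (fun i => (pi_weight phi (enum_val i))%:C).
- by move=> i; rewrite ltcR pi_weight_gt0.
- rewrite !mxE (conjc_real _ : Num.conj _%:C = _) -!rmorphM; congr (_%:C).
  exact: A_entry_sym.
(* Both lists are the roots, with multiplicity, of the characteristic polynomial of A_n, computed
   once from the triangular form and once from the diagonalisation. *)
have pd : perm_eq [seq (eigval F phi n (Nnz s))%:C | s <- Eseq F n]
                  [seq d 0 k | k <- index_enum 'I_#|{: Bq F n}|].
  have pN := perm_map (fun k => (eigval F phi n k)%:C) (perm_Nnz_dim F n).
  move: pN; rewrite -!map_comp => /perm_trans; apply.
  apply: prod_XsubC_eq; rewrite !big_map.
  transitivity (char_poly (A_mx F phi n)).
    rewrite (_ : A_mx F phi n = map_mx (real_complex R)
      (\matrix_(i, j) A_entry phi (enum_val i) (enum_val j))); last first.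
      by apply/matrixP => i j; rewrite !mxE.
    rewrite -map_char_poly char_poly_A_entry rmorph_prod; apply: eq_bigr => X _.
    by rewrite /= map_polyXsubC.
  rewrite (char_poly_intertwine AU) -?unitfE -?unitmxE //.
  (* A constant height is enough, since [diag_mx d] has no nonzero entry off the diagonal. *)
  rewrite (char_poly_height (h := fun=> 0%N)).
    by apply: eq_bigr => i _; rewrite mxE eqxx.
  by move=> i j; rewrite mxE; case: (eqVneq i j) => [->|]; [left | rewrite mulr0n eqxx].
(* A default column index for the matching. *)
have k0 : 'I_#|{: Bq F n}| := enum_rank (fullv : Bq F n).
(* [h] sends each sequence to a column of [U] with the prescribed eigenvalue, using every column
   exactly once; basis and orthogonality then come from [U]. *)
have [h [ph hd]] := perm_map_factor k0 (Eseq_uniq F n) pd.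
have h_inj : {in Eseq F n &, injective h}.
  by apply: uniq_map_inj_in; rewrite (perm_uniq ph) index_enum_uniq.
exists (fun s => col (h s) U); split=> [s sE| |s t sE tE st].
- rewrite -hF -/(eigval F phi n (Nnz s)) -hd // colE mulmxA AU -!colE.
  by apply/colP => i; rewrite mul_mx_diag !mxE mulrC.
- rewrite (map_comp (fun k => col k U) h).
  by rewrite (perm_basis _ (perm_map _ ph)) basis_col.
rewrite /dot_pi (reindex _ (onW_bij _ (@enum_val_bij (Bq F n)))) /=.
under eq_bigr do rewrite !mxE enum_valK.
have /negPf hst : h s != h t by apply: contra_not_neq st => /h_inj; apply.
by have := orthU (h s) (h t); rewrite hst.
Qed.
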